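(* Let $\mathscr{B}\subset\mathbb{N}\setminus\{1\}$ be primitive and taut, and let $\eta=\mathbf{1}_{\mathcal{F}_{\mathscr{B}}}$. Assume that $X_\eta=X_{\mathscr{C}}$ for some primitive set $\mathscr{C}\subset\mathbb{N}\setminus\{1\}$. Then $\mathscr{B}$ is Erdős and $\mathscr{B}=\mathscr{C}$.
   Context: $\mathbb{N}=\{1,2,\ldots\}$. A set of natural numbers is primitive if none of its elements divides a different element of the set. $\mathcal{F}_{\mathscr{B}}=\mathbb{Z}\setminus\bigcup_{b\in\mathscr{B}}b\mathbb{Z}$. The logarithmic density of $A$ is $\delta(A)=\lim_{n\to\infty}\frac{1}{\log n}\sum_{j\in A,\,1\le j\le n}\frac1j$ (it always exists for $A=\mathcal{F}_{\mathscr{B}}$, by the Davenport-Erdős theorem). $\mathscr{B}$ is taut if $\delta(\mathcal{F}_{\mathscr{B}})<\delta(\mathcal{F}_{\mathscr{B}\setminus\{b\}})$ for every $b\in\mathscr{B}$. $\mathscr{B}$ is Erdős if it is infinite, pairwise coprime, and $\sum_{b\in\mathscr{B}}1/b<\infty$. $S$ is the left shift on $\{0,1\}^{\mathbb{Z}}$ and $X_\eta:=\overline{\{S^j\eta:j\in\mathbb{Z}\}}$. $X_{\mathscr{C}}$ is the set of all $x\in\{0,1\}^{\mathbb{Z}}$ whose support $\{i:x(i)=1\}$ misses at least one residue class modulo $c$, for every $c\in\mathscr{C}$. *)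

(* Defs.v *)
From HB Require Import structures.
From mathcomp Require Import all_boot all_order all_algebra.
From mathcomp Require Import all_classical all_reals all_analysis.
Set Implicit Arguments.
Unset Strict Implicit.
Unset Printing Implicit Defensive.
Import Order.TTheory GRing.Theory Num.Theory.
Import numFieldNormedType.Exports.
Local Open Scope classical_set_scope.
Local Open Scope ring_scope.

(* Subsets of N \ {1}, with N = {1, 2, ...}, are terms of
   type [set nat] that are included in [nat_ge2]. *)
Definition nat_ge2 : set nat := [set b | (1 < b)%N].

Definition primitive_set (B : set nat) : Prop :=
  forall a b : nat, B a -> B b -> a <> b -> ~~ (a %| b)%N.

Definition Bfree (B : set nat) : set int :=
  ~` \bigcup_(b in B) [set m : int | (b%:Z %| m)%Z].

Definition log_mean (R : realType) (A : set int) (n : nat) : R :=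
  (ln n%:R)^-1 * \sum_(1 <= j < n.+1 | `[< A j%:Z >]) j%:R^-1.

(* [lim] is a total operator, so this is the logarithmic density only for
   sets that have one; every [Bfree B] does (Davenport-Erdos). *)
Definition log_density (R : realType) (A : set int) : R :=
  lim (log_mean R A @ \oo).

Definition taut (R : realType) (B : set nat) : Prop :=
  forall b : nat, B b ->
    log_density R (Bfree B) < log_density R (Bfree (B `\ b)).

Definition pairwise_coprime (B : set nat) : Prop :=
  forall a b : nat, B a -> B b -> a <> b -> coprime a b.

Definition Erdos (R : realType) (B : set nat) : Prop :=
  [/\ infinite_set B, pairwise_coprime B &
      (\esum_(b in B) ((b%:R^-1 : R)%:E) < +oo)%E].

(* {0,1}^Z with the product of the discrete topologies. *)
Definition fullshift := prod_topology (fun _ : int => bool).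

Definition shift (x : fullshift) : fullshift := fun i => x (i + 1).

(* The j-th power of [shift], for j in Z; see the lemmas below. *)
Definition shiftz (j : int) (x : fullshift) : fullshift := fun i => x (i + j).

Lemma shiftz1 : shiftz 1 = shift.
Proof. by []. Qed.

Lemma shiftz0 (x : fullshift) : shiftz 0 x = x.
Proof. by apply/funext => i; rewrite /shiftz addr0. Qed.

Lemma shiftzD (j k : int) (x : fullshift) :
  shiftz (j + k) x = shiftz j (shiftz k x).
Proof. by apply/funext => i; rewrite /shiftz addrA. Qed.

Definition orbit_closure (x : fullshift) : set fullshift :=
  closure [set shiftz j x | j in [set: int]].

Definition char_seq (A : set int) : fullshift := fun i => `[< A i >].

Definition support01 (x : fullshift) : set int := [set i | x i = true].

Definition admissible (C : set nat) : set fullshift :=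
  [set x | forall c : nat, C c ->
     exists r : int, forall i : int, support01 x i -> ~ (i = r %[mod c%:Z])%Z].

(* Main.v *)
Require Import Defs.
From HB Require Import structures.
From mathcomp Require Import all_boot all_order all_algebra.
From mathcomp Require Import all_classical all_reals all_analysis.
From mathcomp Require Import lra.
Import Order.TTheory GRing.Theory Num.Theory.
Import numFieldNormedType.Exports.
Local Open Scope classical_set_scope.
Local Open Scope ring_scope.

(* Write F for F_B. If X_C is contained in X_eta, every finite C-admissible set
   has a translate inside F. Moreover, a set of residues modulo m lifts to
   integers that miss a class modulo every c not dividing m, so only the c in C
   that divide m constrain which residues modulo m some translate of F meets.
   - If no c in C divided some b in B, a translate of F would meet all classes
     modulo b; but F misses 0.
   - For c in C, the nonzero residues modulo c show that F misses only one class
     r modulo c. As F = -F, c divides 2r, so the representative of r in (0, c]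
     divides c; being outside F, it is a multiple of some b in B.
   By primitivity B = C. If a, b in B were distinct and not coprime, sieving by
   one nonzero class modulo a and by 0 modulo the other elements of B would give
   a B-admissible set no translate of which lies in F. Finally, if the sum of 1/b
   diverged, both F_B and F_(B \ b) would have logarithmic density 0,
   contradicting tautness. *)

(** * Residues and their lifts *)

(** Once the common factor [d] is taken out, the class of [-j] modulo [b] becomes a progression
    [a + c * t] with [a] and [c] coprime, which has a term coprime to [m]. *)
Lemma exists_shift_gcdn (b m j : nat) : (0 < b)%N -> (0 < m)%N ->
  exists n, (b %| n + j)%N /\ (gcdn n m %| b)%N.
Proof.
move=> b0 m0; set k := (b * j.+1 - j)%N.
have jb : (j < b * j.+1)%N := leq_pmull _ b0.
have k0 : (0 < k)%N by rewrite subn_gt0.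
have bk : (b %| k + j)%N by rewrite subnK ?dvdn_mulr// ltnW.
set d := gcdn k b; have d0 : (0 < d)%N by rewrite gcdn_gt0 k0.
(* Each prime of [m] divides exactly one of [a] and [t]; as [a] and [c] are coprime, none divides
   [a + c * t]. *)
set a := (k %/ d)%N; set c := (b %/ d)%N; set t := (m`_(\pi(a)^'))%N.
have kE : (d * a = k)%N by rewrite mulnC divnK ?dvdn_gcdl.
have bE : (d * c = b)%N by rewrite mulnC divnK ?dvdn_gcdr.
have a0 : (0 < a)%N by rewrite -(ltn_pmul2l d0) muln0 kE.
have cac : coprime a c.
  by rewrite /coprime -(eqn_pmul2l d0) muln_gcdr kE bE muln1.
exists (d * (a + c * t))%N; split.
  by rewrite mulnDr kE mulnA bE -addnA addnCA dvdn_addr ?dvdn_mulr.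
suff cop : coprime (a + c * t) m.
  rewrite gcdnC Gauss_gcdl 1?coprime_sym//.
  exact: dvdn_trans (dvdn_gcdr _ _) (dvdn_gcdr _ _).
apply/negPn/negP => ncop; set g := gcdn (a + c * t) m.
have g1 : (1 < g)%N by rewrite ltn_neqAle eq_sym ncop gcdn_gt0 m0 orbT.
have pp := pdiv_prime g1; set p := pdiv g in pp.
have pu : (p %| a + c * t)%N := dvdn_trans (pdiv_dvd _) (dvdn_gcdl _ _).
have pm : (p %| m)%N := dvdn_trans (pdiv_dvd _) (dvdn_gcdr _ _).
have ptE : (p %| t)%N = ~~ (p %| a)%N.
  have := pi_of_part (\pi(a)^')%N m0 p.
  by rewrite !inE !mem_primes pp m0 pm a0 /= part_gt0.
have [pa|pa] := boolP (p %| a)%N.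
  move: pu; rewrite dvdn_addr// Euclid_dvdM// ptE pa orbF => pc.
  have : (p %| gcdn a c)%N by rewrite dvdn_gcd pa.
  by rewrite (eqP cac) dvdn1 => /eqP p1; rewrite p1 in pp.
by move: pu; rewrite dvdn_addl ?(negPf pa)// dvdn_mull// ptE.
Qed.

(* The residue of [i] modulo [m] fixes the last [logn p m] base-[p] digits of
   [n]; the next digit is free, and is chosen to be 0. *)
Lemma exists_small_residues (m i : nat) (s : seq nat) : (0 < m)%N ->
    uniq s -> all prime s ->
  exists n, (n = i %[mod m])%N /\
    forall p, p \in s -> (n %% p ^ (logn p m).+1 < p ^ logn p m)%N.
Proof.
move=> m0 us ps.
elim: s us ps => [_ _|p s IH /= /andP[ps us] /andP[pp sp]].
  by exists i.
have [n [nE nP]] := IH us sp; set a := logn p m.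
set M := (m`_(p^') * \prod_(q <- s) q)%N.
have mE : (m = p ^ a * m`_(p^'))%N by rewrite -p_part partnC.
have copp : coprime p (\prod_(q <- s) q)%N.
  rewrite prime_coprime//; apply/negP.
  elim: (s) ps sp => [|q r IHr].
    by rewrite big_nil dvdn1 => _ _ /eqP p1; rewrite p1 in pp.
  rewrite inE negb_or big_cons Euclid_dvdM//= => /andP[pq pr] /andP[qp rp].
  by rewrite dvdn_prime2// (negPf pq)/=; apply: IHr.
have copM : coprime p M.
  rewrite coprimeMr copp andbT prime_coprime//; apply/negP => pm.
  have := pi_of_part (p^')%N m0 p.
  by rewrite !inE !mem_primes pp pm part_gt0 /= eqxx andbF.
have cop (e : nat) : coprime (p ^ e) M by rewrite coprimeXl.
pose x := chinese (p ^ a.+1) M (n %% p ^ a) n.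
have xp : (x = n %% p ^ a %[mod p ^ a.+1])%N by apply: chinese_modl.
have xM : (x = n %[mod M])%N by apply: chinese_modr.
have lta : (n %% p ^ a < p ^ a)%N by rewrite ltn_mod expn_gt0 prime_gt0.
(* This modulus preserves the residue modulo [m] and, for each [q] in [s], the digit already set to
   0. *)
have xQ : (x = n %[mod m * \prod_(q <- s) q])%N.
  rewrite {1 2}mE -mulnA -/M; apply/eqP.
  rewrite chinese_remainder// xM eqxx andbT; apply/eqP.
  rewrite -(modn_dvdm x (dvdn_exp2l p (leqnSn a))) xp.
  by rewrite modn_dvdm ?modn_mod// dvdn_exp2l.
exists x; split.
  rewrite -nE -(modn_dvdm x (dvdn_mulr (\prod_(q <- s) q)%N (dvdnn m))) xQ.
  by rewrite modn_dvdm// dvdn_mulr.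
move=> q; rewrite inE => /predU1P[->|qs].
  by rewrite -/a xp modn_small// (ltn_trans lta)// ltn_exp2l// prime_gt1.
have pq : prime q := allP sp q qs.
suff qd : (q ^ (logn q m).+1 %| m * \prod_(q <- s) q)%N.
  by rewrite -(modn_dvdm x qd) xQ modn_dvdm// nP.
by rewrite expnSr dvdn_mul ?pfactor_dvdnn// (big_rem q)//= dvdn_mulr.
Qed.

(** If [c <= m], some prime [p <= m] has a higher power in [c] than in [m], and the zero digit of
    [f i] there leaves a class free. If [c > m], the [m] values cannot fill [c] classes. *)
Lemma exists_lift (m : nat) : (0 < m)%N ->
  exists f : nat -> nat, (forall i, f i = i %[mod m])%N /\
    forall c, (0 < c)%N -> ~~ (c %| m)%N ->
    exists r, forall i, (i < m)%N -> (f i <> r %[mod c])%N.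
Proof.
move=> m0; pose ps := primes m`!.
have prime_ps : all prime ps.
  by apply/allP => p; rewrite mem_primes => /and3P[].
have [f fP] :=
  choice (fun i => exists_small_residues m i ps m0 (primes_uniq _) prime_ps).
exists f; split => [i|c c0 cm]; first by have [] := fP i.
have [cltm|mltc] := leqP c m; last first.
  apply: contrapT => /forallNP h.
  have surj (r : 'I_c) : exists i : 'I_m, (f i = r %[mod c])%N.
    apply: contrapT => /forallNP hr; apply: (h r) => i im; exact: (hr (Ordinal im)).
  have [g gP] := choice surj.
  have g_inj : injective g.
    move=> r r' e; apply/val_inj.
    by rewrite /= -(modn_small (ltn_ord r)) -gP e gP modn_small.
  by have := leq_card g g_inj; rewrite !card_ord leqNgt mltc.
have /existsNP[p /not_implyP[pc /negP pm]] :
    ~ forall p : nat, p \in \pi(c) -> (c`_p %| m)%N.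
  by move=> /(dvdn_partP _ c0); apply/negP.
move: pc; rewrite mem_primes => /and3P[pp _ pc].
have plt : (logn p m < logn p c)%N.
  by rewrite ltnNge; apply/negP => h; move: pm; rewrite p_part pfactor_dvdn// h.
have qc : (p ^ (logn p m).+1 %| c)%N by rewrite pfactor_dvdn.
(* The digit in question is 1 for this class and 0 for every [f i]. *)
exists (p ^ logn p m)%N => i im e.
have [_ /(_ p)] := fP i.
have -> : p \in ps.
  rewrite mem_primes pp fact_gt0 /= dvdn_fact// prime_gt0//=.
  by rewrite (leq_trans _ cltm)// dvdn_leq.
move=> /(_ isT); rewrite -(modn_dvdm _ qc) e modn_dvdm// modn_small ?ltnn//.
by rewrite ltn_exp2l// prime_gt1.
Qed.

(** * Translates inside the set of [B]-free integers *)

(** Prescribing finitely many coordinates defines a neighbourhood in the product topology. *)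
Lemma orbit_closure_window (x y : fullshift) (s : seq int) :
  orbit_closure x y -> exists j : int, forall i, i \in s -> x (i + j) = y i.
Proof.
move=> xy.
have /xy[_ [[j _ <-] H]] : nbhs y [set z : fullshift | forall i, i \in s -> z i = y i].
  elim: s => [|i s IH]; first by apply: filterS filterT => z _ i; rewrite in_nil.
  have yi : nbhs y [set z : fullshift | z i = y i].
    exact: (@proj_continuous int (fun=> bool) i y [set y i] (discrete_set1 _)).
  by apply: filterS (filterI yi IH) => z [zi zs] k; rewrite inE => /predU1P[->|/zs].
by exists j.
Qed.

Lemma BfreeP (B : set nat) (n : int) :
  Bfree B n <-> forall b, B b -> ~~ (b%:Z %| n)%Z.
Proof.
split=> [h b Bb|h [b Bb /=]]; last exact/negP/h.
by apply/negP => bn; apply: h; exists b.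
Qed.

(** The lifts of [I] form a finite set that is [C]-admissible: the hypothesis handles [c] dividing
    [m], and [exists_lift] all other [c]. *)
Lemma Bfree_translate (B C : set nat) (m : nat) (I : set nat) : (0 < m)%N ->
    C `<=` nat_ge2 ->
    admissible C `<=` orbit_closure (char_seq (Bfree B)) ->
    (forall c, C c -> (c %| m)%N ->
      exists r, forall i, I i -> (i < m)%N -> (i <> r %[mod c])%N) ->
  exists j : nat, forall i, I i -> (i < m)%N ->
    exists n : int, (n = (i + j)%N %[mod m])%Z /\ Bfree B n.
Proof.
move=> m0 C2 CB Im; have [f [fm fmiss]] := exists_lift m m0.
pose x := char_seq [set (f i)%:Z | i in [set i | I i /\ (i < m)%N]].
have Cx : admissible C x.
  move=> c Cc; have c0 : (0 < c)%N by apply: ltnW; apply: C2.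
  have [cm|cm] := boolP (c %| m)%N.
    have [r rP] := Im c Cc cm; exists r%:Z => _ /asboolP[i [Ii im] <-].
    rewrite !modz_nat => -[]; rewrite -(modn_dvdm _ cm) fm modn_dvdm//.
    exact: rP.
  have [r rP] := fmiss c c0 cm; exists r%:Z => _ /asboolP[i [Ii im] <-].
  by rewrite !modz_nat => -[]; exact: rP.
have [j jP] :=
  orbit_closure_window _ _ [seq (f i)%:Z | i <- iota 0 m] (CB x Cx).
(* The translation is an integer; only its residue modulo [m] matters. *)
exists `|(j %% m)%Z|%N => i Ii im; exists ((f i)%:Z + j); split.
  have mn0 : m%:Z != 0 by rewrite eqz_nat -lt0n.
  rewrite PoszD gez0_abs ?modz_ge0// -modzDml modzDmr.
  by rewrite modz_nat fm -modz_nat modzDml.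
have /jP : (f i)%:Z \in [seq (f i)%:Z | i <- iota 0 m].
  by apply/mapP; exists i => //; rewrite mem_iota.
rewrite /x /char_seq => e; apply/asboolP; rewrite e; apply/asboolP.
by exists i.
Qed.

Lemma dvdz_eqmod (b m : nat) (x y : int) :
  (b %| m)%N -> (x = y %[mod m])%Z -> (b%:Z %| x)%Z = (b%:Z %| y)%Z.
Proof.
move=> bm xy; have bmz : (b%:Z %| m%:Z)%Z by [].
apply/idP/idP => h; [move/eqP: xy; rewrite eq_sym|move/eqP: xy];
  by rewrite eqz_mod_dvd => /(dvdz_trans bmz); rewrite rpredBr.
Qed.

(** * Divisibility between [B] and [C], coprimality, infinitude *)

Lemma dvdn_of_admissible_sub (B C : set nat) (b : nat) : B `<=` nat_ge2 ->
  C `<=` nat_ge2 -> admissible C `<=` orbit_closure (char_seq (Bfree B)) ->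
  B b -> exists c, C c /\ (c %| b)%N.
Proof.
move=> B2 C2 CB Bb; apply: contrapT => /forallNP h.
have b0 : (0 < b)%N by apply: ltnW; apply: B2.
have [j jP] : exists j : nat, forall i, [set: nat] i -> (i < b)%N ->
    exists n : int, (n = (i + j)%N %[mod b])%Z /\ Bfree B n.
  by apply: (Bfree_translate _ _ _ _ b0 C2 CB) => c Cc cb; case: (h c).
have [n [bn _]] := exists_shift_gcdn b b j b0 b0.
have [z [ze /BfreeP/(_ b Bb)]] := jP (n %% b)%N I (ltn_pmod n b0).
rewrite (dvdz_eqmod _ _ _ _ (dvdnn b) ze) dvdzE !absz_nat.
by rewrite /dvdn modnDml -/(dvdn _ _) bn.
Qed.

Lemma dvdn_of_admissible (B C : set nat) (c : nat) :
  C `<=` nat_ge2 -> primitive_set C -> admissible C (char_seq (Bfree B)) ->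
  admissible C `<=` orbit_closure (char_seq (Bfree B)) ->
  C c -> exists b, B b /\ (b %| c)%N.
Proof.
move=> C2 Cprim CF CB Cc; have c0 : (0 < c)%N by apply: ltnW; apply: C2.
have cn0 : c%:Z != 0 by rewrite eqz_nat -lt0n.
(* By primitivity, [c] is the only element of [C] dividing [c], and the nonzero residues miss 0. *)
have [j jP] : exists j : nat, forall i, (0 < i)%N -> (i < c)%N ->
    exists n : int, (n = (i + j)%N %[mod c])%Z /\ Bfree B n.
  apply: (Bfree_translate _ _ _ (fun i => 0 < i)%N c0 C2 CB) => c' Cc' cc'.
  have -> : c' = c.
    by apply: contrapT => ne; have := Cprim _ _ Cc' Cc ne; rewrite cc'.
  by exists 0%N => i i0 ic; rewrite mod0n modn_small//; case: i i0 ic.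
(* If [s] is not congruent to [j], then [s - j] is a nonzero residue, so its translate by [j] meets
   the [B]-free set. *)
have uniq_missed s :
    (forall n, Bfree B n -> ~ (n = s %[mod c])%Z) -> (s = j %[mod c])%Z.
  move=> smiss; apply/eqP; rewrite eqz_mod_dvd; apply/negPn/negP => cs.
  have [n [ne nF]] : exists n : int,
      (n = (`|((s - j%:Z)%R %% c)%Z| + j)%N %[mod c])%Z /\ Bfree B n.
    apply: jP; last by rewrite -ltz_nat gez0_abs ?modz_ge0// ltz_pmod.
    by rewrite absz_gt0; apply: contra cs => /eqP/dvdz_mod0P.
  apply: (smiss n nF); rewrite ne PoszD gez0_abs ?modz_ge0//.
  by rewrite modzDml subrK.
have [r rP] := CF c Cc.
have rmiss n : Bfree B n -> ~ (n = r %[mod c])%Z.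
  by move=> nF; apply: rP; apply/asboolP.
have jr := uniq_missed r rmiss.
have jNr : (- r = j %[mod c])%Z.
  apply: uniq_missed => n nF e; apply: (rmiss (- n)).
    by apply/BfreeP => b Bb; rewrite rpredN; move/BfreeP: nF; apply.
  by rewrite -modzNm e modzNm opprK.
have c2j : (c %| j + j)%N.
  have : (c%:Z %| (j + j)%N%:Z)%Z.
    apply/dvdz_mod0P; rewrite PoszD -modzDml -jr modzDml -modzDmr -jNr modzDmr.
    by rewrite subrr mod0z.
  by [].
(* The class 0 is represented by [c]: a divisor of 0 need not divide [c]. *)
pose k := if (j %% c)%N == 0%N then c else (j %% c)%N.
have k0 : (0 < k)%N by rewrite /k; case: eqP => // /eqP; rewrite lt0n.
have kc : (k <= c)%N by rewrite /k; case: eqP => // _; rewrite ltnW// ltn_mod.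
have kj : (k = j %[mod c])%N.
  by rewrite /k; case: eqP => [->|_]; rewrite ?modnn// modn_mod.
have c2k : (c %| k + k)%N by rewrite /dvdn -modnDm kj modnDm.
have kdc : (k %| c)%N.
  (* Here [0 < k + k < 2 * c] forces [k + k = c]. *)
  case: (ltngtP k c) kc => // [klt _|-> //]; case/dvdnP: c2k => q qE.
  have q2 : (q < 2)%N by rewrite -(ltn_pmul2r c0) -qE mul2n -addnn -addSn leq_add// ltnW.
  case: q q2 qE => [|[|//]] _ qE; first by move/eqP: qE; rewrite mul0n addn_eq0 gtn_eqF.
  by rewrite -[c]mul1n -qE dvdn_addr.
have : ~ Bfree B k.
  move=> kF; apply: (rmiss _ kF); rewrite jr !modz_nat; congr Posz; exact: kj.
move=> /contrapT[b Bb /= bk]; exists b; split=> //.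
exact: dvdn_trans bk kdc.
Qed.

(* [key] sieves by the class of [s] modulo [a] and by 0 modulo the other
   elements of [B]: if a translate by [j] of what remains avoids the multiples of
   [b] and of [a], then [b %| j] and [a %| s + j]. *)
Lemma pairwise_coprime_of_admissible_sub (B : set nat) :
  B `<=` nat_ge2 -> primitive_set B ->
  admissible B `<=` orbit_closure (char_seq (Bfree B)) -> pairwise_coprime B.
Proof.
move=> B2 Bprim BF.
have key a b s : B a -> B b -> a <> b -> (s %| a)%N -> ~~ (s %| b)%N ->
    (gcdn a b %| s)%N.
  move=> Ba Bb ab sa sb; apply: contrapT => gs.
  have a0 : (0 < a)%N by apply: ltnW; apply: B2.
  have b0 : (0 < b)%N by apply: ltnW; apply: B2.
  set m := (a * b)%N; have m0 : (0 < m)%N by rewrite muln_gt0 a0.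
  have am : (a %| m)%N by rewrite dvdn_mulr.
  have bm : (b %| m)%N by rewrite dvdn_mull.
  pose I := [set i : nat | (i <> s %[mod a])%N /\
    forall d, B d -> d <> a -> (d %| m)%N -> ~~ (d %| i)%N].
  have [j jP] : exists j : nat, forall i, I i -> (i < m)%N ->
      exists n : int, (n = (i + j)%N %[mod m])%Z /\ Bfree B n.
    apply: (Bfree_translate _ _ _ _ m0 B2 BF) => d Bd dm.
    have [->|/eqP da] := eqVneq d a; first by exists s => i [].
    exists 0%N => i [_ /(_ d Bd da dm) di] _.
    by rewrite mod0n => /eqP; exact/negP.
  have dvdP e n : B e -> (e %| m)%N -> (e %| n + j)%N -> ~ I (n %% m)%N.
    move=> Be em en In; have [z [ze]] := jP _ In (ltn_pmod n m0).
    move=> /BfreeP/(_ e Be); rewrite (dvdz_eqmod _ _ _ _ em ze) dvdzE !absz_nat.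
    by rewrite /dvdn -modnDml modn_dvdm// modnDml -/(dvdn _ _) en.
  (* By primitivity, [gcdn n m %| e] leaves [e] as the only element of [B] that can divide both [n]
     and [m]. *)
  have inI e n : B e -> (e %| n + j)%N -> (gcdn n m %| e)%N ->
      (n <> s %[mod a])%N -> (e = a \/ ~~ (e %| n)%N) -> I (n %% m)%N.
    move=> Be en ge ns ean; split; first by rewrite modn_dvdm.
    move=> d Bd da dm; rewrite /dvdn modn_dvdm// -/(dvdn _ _).
    apply/negP => dn.
    have de : (d %| e)%N by apply: dvdn_trans ge; rewrite dvdn_gcd dn.
    have eqde : d = e.
      by apply: contrapT => ne; have := Bprim _ _ Bd Be ne; rewrite de.
    case: ean => [ea|/negP]; first by apply: da; rewrite eqde.
    by rewrite -eqde.
  have bj : (b %| j)%N.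
    have [n [bn gn]] := exists_shift_gcdn b m j b0 m0.
    apply/negPn/negP => nbj; apply: (dvdP b n Bb bm bn).
    apply: (inI b n Bb bn gn).
      (* As [s] divides [a], the congruence would give [s %| n], hence [s %| gcdn n m] and
         [s %| b]. *)
      move=> e; move/negP: sb; apply; apply: dvdn_trans gn.
      rewrite dvdn_gcd (dvdn_trans sa am) andbT.
      by rewrite /dvdn -(modn_dvdm _ sa) e modn_dvdm// modnn.
    by right; apply: contra nbj => h; rewrite -(dvdn_addr _ h).
  have [n [an gn]] := exists_shift_gcdn a m j a0 m0.
  apply: (dvdP a n Ba am an); apply: (inI a n Ba an gn); last by left.
  move=> e; apply: gs.
  have asj : (a %| s + j)%N by rewrite /dvdn -modnDml -e modnDml.
  have gsj := dvdn_trans (dvdn_gcdl a b) asj.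
  by rewrite -(dvdn_addl _ (dvdn_trans (dvdn_gcdr a b) bj)).
(* By primitivity some [p]-part of [a] does not divide [b]; it serves as [s] in [key]. *)
have part a b : B a -> B b -> a <> b ->
    exists p, [/\ prime p, (gcdn a b %| a`_p)%N & ~~ (a`_p %| b)%N].
  move=> Ba Bb ab; have a0 : (0 < a)%N by apply: ltnW; apply: B2.
  have /existsNP[p /not_implyP[pa /negP pb]] :
      ~ forall p : nat, p \in \pi(a) -> (a`_p %| b)%N.
    by move=> /(dvdn_partP _ a0); apply/negP; exact: Bprim.
  exists p; split => //; first by move: pa; rewrite mem_primes => /and3P[].
  exact: key (dvdn_part _ _) pb.
move=> a b Ba Bb ab.
have [p [pp gp pb]] := part a b Ba Bb ab.
have [q [qp gq qa]] := part b a Bb Ba (nesym ab).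
(* For a common prime, one of the two parts would divide the other. *)
have pq : p != q.
  apply/eqP => pq; rewrite -{}pq !p_part in qa pb.
  case/orP: (leq_total (logn p a) (logn p b)) => h.
    by move/negP: pb; apply; apply: dvdn_trans (dvdn_exp2l p h) (pfactor_dvdnn _ _).
  by move/negP: qa; apply; apply: dvdn_trans (dvdn_exp2l p h) (pfactor_dvdnn _ _).
have cpq : coprime (a`_p)%N (b`_q)%N.
  by rewrite !p_part coprimeXl// coprimeXr// prime_coprime// dvdn_prime2.
by rewrite /coprime -dvdn1 -(eqP cpq) dvdn_gcd gp gcdnC gq.
Qed.

(** The zero sequence is admissible, so the [B]-free set has arbitrarily long gaps. For finite [B]
    it would contain the whole class of 1 modulo the product of [B]. *)
Lemma infinite_of_admissible_sub (B C : set nat) : B `<=` nat_ge2 ->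
  admissible C `<=` orbit_closure (char_seq (Bfree B)) -> infinite_set B.
Proof.
move=> B2 CB /finite_seqP[s Bs]; pose m := (\prod_(b <- s) b)%N.
have m0 : m%:Z != 0.
  rewrite eqz_nat -lt0n /m big_seq prodn_cond_gt0// => b bs.
  by apply: ltnW; apply: B2; rewrite Bs.
have C0 : admissible C (char_seq set0) by move=> c _; exists 0 => i /asboolP[].
have [j jP] := orbit_closure_window _ _ [seq i%:Z | i <- iota 0 m] (CB _ C0).
(* Translating this position by [j] gives the class of 1 modulo [m]. *)
have /jP : ((1 - j) %% m)%Z \in [seq i%:Z | i <- iota 0 m].
  apply/mapP; exists `|((1 - j) %% m)%Z|%N; last by rewrite gez0_abs ?modz_ge0.
  by rewrite mem_iota /= -ltz_nat gez0_abs ?modz_ge0// ltz_pmod// lt0r m0.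
rewrite /char_seq (asboolF (_ : ~ set0 _))// => /asboolPn; apply.
apply/BfreeP => b Bb.
have bs : b \in s by rewrite Bs in Bb.
have bm : (b %| m)%N by rewrite /m (big_rem b)//= dvdn_mulr.
have e : (((1 - j) %% m)%Z + j = 1 %[mod m])%Z by rewrite modzDml subrK.
rewrite (dvdz_eqmod _ _ _ _ bm e) dvdzE /= dvdn1.
by have := B2 b Bb; rewrite /nat_ge2 /=; case: b {Bb bs bm} => [|[]].
Qed.

(** * Sieve bounds for logarithmic sums *)

Section LogarithmicSums.
Context (R : realType).

Definition inv_sum (P : pred nat) (n : nat) : R :=
  \sum_(1 <= j < n.+1 | P j) j%:R^-1.

Lemma inv_sumS P n :
  inv_sum P n.+1 = inv_sum P n + (if P n.+1 then n.+1%:R^-1 else 0).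
Proof. by rewrite /inv_sum [LHS]big_mkcond big_nat_recr//= -big_mkcond. Qed.

Lemma inv_sum0 P : inv_sum P 0 = 0.
Proof. by rewrite /inv_sum big_geq. Qed.

Lemma inv_sum_ge0 P n : 0 <= inv_sum P n.
Proof. by apply: sumr_ge0 => j _; rewrite invr_ge0. Qed.

Lemma le_inv_sum (P Q : pred nat) n :
  (forall j, P j -> Q j) -> inv_sum P n <= inv_sum Q n.
Proof.
move=> PQ; elim: n => [|n IH]; first by rewrite !inv_sum0.
rewrite !inv_sumS lerD//.
by case: (boolP (P _)) => [/PQ->//|_]; case: ifP.
Qed.

Lemma inv_sumID (P Q : pred nat) n :
  inv_sum P n = inv_sum (predI P Q) n + inv_sum (predD P Q) n.
Proof.
by rewrite /inv_sum (bigID Q)/=; congr (_ + _); apply: eq_bigl => j /=; rewrite andbC.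
Qed.

Lemma inv_sum_multiples (P : pred nat) (b n : nat) : (0 < b)%N ->
  (forall j, P (b * j)%N = P j) ->
  inv_sum (predI P (dvdn b)) n = b%:R^-1 * inv_sum P (n %/ b)%N.
Proof.
move=> b0 Pb; elim: n => [|n IH]; first by rewrite div0n !inv_sum0 mulr0.
rewrite inv_sumS IH divnS//=; have [bn|bn] := boolP (b %| n.+1)%N; last first.
  by rewrite andbF addr0.
have nE : n.+1 = (b * (n %/ b).+1)%N.
  by rewrite -{1}(divnK bn) divnS// bn mulnC.
rewrite inv_sumS mulrDr andbT {1 2}nE Pb; case: ifP => _; last by rewrite mulr0.
by rewrite natrM invfM.
Qed.

(** Each of the at most [n] terms with [j > n / b] is at most [b / n]. *)
Lemma inv_sum_le_divn (P : pred nat) (b n : nat) : (0 < b)%N ->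
  inv_sum P n <= inv_sum P (n %/ b)%N + b%:R.
Proof.
move=> b0; have [->|n0] := posnP n; first by rewrite div0n inv_sum0 add0r.
rewrite /inv_sum (@big_cat_nat _ _ _ (n %/ b).+1)//= ?ltnS ?leq_div// lerD2l.
rewrite big_mkcond /=.
apply: (@le_trans _ _ (\sum_((n %/ b).+1 <= j < n.+1) (b%:R / n%:R))).
  apply: ler_sum_nat => j /andP[bj _]; case: ifP => _; last by rewrite divr_ge0.
  have j0 : (0 < j)%N by apply: leq_trans bj.
  rewrite ler_pdivlMr ?ltr0n// ler_pdivrMl ?ltr0n// -natrM ler_nat.
  by rewrite ltn_divLR// in bj; apply: ltnW.
rewrite sumr_const_nat subSS -[_ *+ _]mulr_natr -mulrA ler_piMr//.
by rewrite ler_pdivrMl ?ltr0n// mulr1 ler_nat leq_subr.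
Qed.

(* As [P] is invariant under multiplication by [b], the multiples of [b] carry
   the fraction [b^-1] of the sum, up to a bounded error. *)
Lemma inv_sum_sieve (P : pred nat) (b n : nat) : (0 < b)%N ->
  (forall j, P (b * j)%N = P j) ->
  inv_sum (predD P (dvdn b)) n <= (1 - b%:R^-1) * inv_sum P n + 1.
Proof.
move=> b0 Pb; have := inv_sumID P (dvdn b) n; rewrite inv_sum_multiples// => e.
have := inv_sum_le_divn P b n b0.
rewrite -(ler_pM2l (x := b%:R^-1)) ?invr_gt0 ?ltr0n// mulrDr mulVf ?pnatr_eq0 -?lt0n//.
by move=> le; rewrite mulrBl mul1r; lra.
Qed.

(** Coprimality makes sieving by [s] invariant under multiplication by a further [b], so
    [inv_sum_sieve] applies repeatedly, each time with an error of at most 1. *)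
Lemma inv_sum_coprime_sieve (s : seq nat) (n : nat) : uniq s ->
  (forall b, b \in s -> (0 < b)%N) ->
  (forall a b, a \in s -> b \in s -> a <> b -> coprime a b) ->
  inv_sum (fun j => all (fun b => ~~ (b %| j)%N) s) n
    <= \prod_(b <- s) (1 - b%:R^-1) * inv_sum predT n + (size s)%:R.
Proof.
elim: s => [|b s IH] /=; first by rewrite big_nil mul1r addr0.
move=> /andP[bs us] spos scop; have b0 : (0 < b)%N by apply: spos; rewrite mem_head.
have Pb j : all (fun d => ~~ (d %| b * j)%N) s = all (fun d => ~~ (d %| j)%N) s.
  apply: eq_in_all => d ds; rewrite Gauss_dvdr//.
  apply: scop; rewrite ?inE ?ds ?eqxx ?orbT//.
  by move=> db; rewrite -db ds in bs.
apply: le_trans (inv_sum_sieve _ b n b0 Pb) _.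
have {}IH : inv_sum (fun j => all (fun b => ~~ (b %| j)%N) s) n
    <= \prod_(b <- s) (1 - b%:R^-1) * inv_sum predT n + (size s)%:R.
  apply: IH => // [d ds|d e ds es]; first by apply: spos; rewrite inE ds orbT.
  by apply: scop; rewrite inE ?ds ?es orbT.
have b1 : b%:R^-1 <= 1 :> R by rewrite invf_le1 ?ltr0n// ler1n.
have bp : 0 <= b%:R^-1 :> R by rewrite invr_ge0.
rewrite big_cons -mulrA -natr1 addrA lerD2r.
apply: le_trans (ler_wpM2l _ IH) _; first by rewrite subr_ge0.
by rewrite mulrDr lerD2l ler_piMl// gerBl.
Qed.

Lemma harmonic_le_ln (n : nat) : inv_sum predT n.+1 <= 1 + ln n.+1%:R.
Proof.
elim: n => [|n IH]; first by rewrite inv_sumS inv_sum0 ln1 invr1 addr0 add0r.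
rewrite inv_sumS /=.
(* This gives [1 / (n + 2) <= ln (n + 2) - ln (n + 1)], which telescopes. *)
have := @le_ln1Dx R (- n.+2%:R^-1).
rewrite ltrN2 invf_lt1 ?ltr0n// ltr1n => /(_ isT).
have -> : 1 - n.+2%:R^-1 = n.+1%:R / n.+2%:R :> R.
  have n2 : n.+2%:R != 0 :> R by rewrite pnatr_eq0.
  by apply: (mulIf n2); rewrite mulrBl mul1r mulVf// divfK// -natr1 addrK.
rewrite ln_div ?posrE ?ltr0n// ; move: IH.
move: (inv_sum _ _) (ln n.+1%:R) (ln n.+2%:R) (n.+2%:R^-1) => a b c x *; lra.
Qed.

Lemma prod_le_expR (s : seq nat) : (forall b, b \in s -> (0 < b)%N) ->
  \prod_(b <- s) (1 - b%:R^-1) <= expR (- \sum_(b <- s) b%:R^-1) :> R.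
Proof.
move=> spos; rewrite -sumrN expR_sum big_seq [leRHS]big_seq.
apply: ler_prod => b /spos b0; rewrite expR_ge1Dx andbT subr_ge0.
by rewrite invf_le1 ?ltr0n// ler1n.
Qed.

(** Sieving by a finite list with a large reciprocal sum already makes the product of the
    [1 - 1 / b] small. *)
Lemma log_density_Bfree0 (B : set nat) :
  B `<=` nat_ge2 -> pairwise_coprime B ->
  (forall M : R, exists s : seq nat,
    [/\ uniq s, {subset s <= mem B} & M < \sum_(b <- s) b%:R^-1]) ->
  log_density R (Bfree B) = 0.
Proof.
move=> B2 Bcop Bdiv; rewrite /log_density; apply: cvg_lim => //.
apply/cvgrPdist_lt => e e0.
have e20 : 0 < e / 2 by rewrite divr_gt0.
have [s [us sB sum_s]] := Bdiv (- ln (e / 2)).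
have {}sB b : b \in s -> B b by move=> /sB; rewrite inE.
have spos b : b \in s -> (0 < b)%N by move=> /sB/B2; apply: ltnW.
set d := \prod_(b <- s) (1 - b%:R^-1) : R.
have de : d < e / 2.
  apply: le_lt_trans (prod_le_expR s spos) _.
  by rewrite -[ltRHS]lnK ?posrE// ltr_expR ltrNl.
have d0 : 0 <= d.
  rewrite /d big_seq; apply: prodr_ge0 => b /spos b0.
  by rewrite subr_ge0 invf_le1 ?ltr0n// ler1n.
near=> n.
(* One half of [e] bounds [d]; for such [n] the other half absorbs the bounded term [d + size s]. *)
have ngt : expR ((d + (size s)%:R) / (e / 2)) < n%:R by near: n; exact: nbhs_infty_gtr.
have n1 : 1 < n%:R :> R.
  apply: le_lt_trans ngt; rewrite -[leLHS]expR0 ler_expR divr_ge0 ?addr_ge0//; exact: ltW.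
have lnn : 0 < ln (n%:R : R) by exact: ln_gt0.
have lngt : (d + (size s)%:R) / (e / 2) < ln n%:R.
  by rewrite -[ltLHS]expRK ltr_ln ?posrE ?expR_gt0// (lt_trans _ n1).
have le_S : \sum_(1 <= j < n.+1 | `[< Bfree B j%:Z >]) j%:R^-1
    <= d * (1 + ln n%:R) + (size s)%:R :> R.
  apply: (@le_trans _ _ (inv_sum (fun j => all (fun b => ~~ (b %| j)%N) s) n)).
    apply: le_inv_sum => j /asboolP/BfreeP jB; apply/allP => b /sB; exact: jB.
  apply: le_trans (inv_sum_coprime_sieve s n us spos _) _.
    by move=> a b /sB Ba /sB Bb; exact: Bcop.
  rewrite lerD2r ler_wpM2l//; case: (n) n1 => [|k _]; last exact: harmonic_le_ln.
  by rewrite ltr10.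
have S0 : 0 <= \sum_(1 <= j < n.+1 | `[< Bfree B j%:Z >]) j%:R^-1 :> R.
  exact: inv_sum_ge0.
rewrite sub0r normrN ger0_norm /log_mean; last by rewrite mulr_ge0// invr_ge0 ltW.
rewrite ltr_pdivrMl//; apply: le_lt_trans le_S _.
move: lngt; rewrite ltr_pdivrMr//; nra.
Unshelve. all: by end_near. Qed.

Lemma taut_esum_lty (B : set nat) : B !=set0 -> B `<=` nat_ge2 ->
  pairwise_coprime B -> taut R B -> (\esum_(b in B) ((b%:R^-1 : R)%:E) < +oo)%E.
Proof.
move=> [b0 Bb0] B2 Bcop Btaut; rewrite ltNge; apply/negP => Binf.
have Bdiv (M : R) : exists s : seq nat,
    [/\ uniq s, {subset s <= mem B} & M < \sum_(b <- s) b%:R^-1].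
  have : (M%:E < \esum_(b in B) ((b%:R^-1 : R)%:E))%E.
    by apply: lt_le_trans Binf; rewrite ltry.
  move=> /ereal_sup_gt[_ [A [finA AB] <-]].
  rewrite fsbig_finite//= sumEFin lte_fin => MA.
  exists (finmap.enum_fset (fset_set A)); split => //.
    exact: finmap.fset_uniq.
  move=> b bA; have : b \in A by rewrite -(in_fset_set finA b).
  by rewrite !inE => /AB.
have := Btaut b0 Bb0; rewrite !log_density_Bfree0 ?ltxx//.
- by move=> b [/B2].
- by move=> a b [Ba _] [Bb _]; exact: Bcop.
(* The extra [1 / b0] compensates for deleting [b0] from the list. *)
move=> M; have [s [us sB sM]] := Bdiv (M + b0%:R^-1).
exists (rem b0 s); split; first exact: rem_uniq.
  move=> b; rewrite mem_rem_uniq// !inE => /andP[bb0 /sB].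
  by rewrite inE => Bb; split => //; apply/eqP.
have [bs|bs] := boolP (b0 \in s).
  by move: sM; rewrite (big_rem b0)//= [ltRHS]addrC ltrD2r.
by rewrite rem_id//; apply: le_lt_trans sM; rewrite lerDl invr_ge0.
Qed.

End LogarithmicSums.

Theorem corollary1p3 (R : realType) (B C : set nat)
    (B_ge2 : B `<=` nat_ge2) (B_primitive : primitive_set B)
    (B_taut : taut R B)
    (C_ge2 : C `<=` nat_ge2) (C_primitive : primitive_set C)
    (X_eq : orbit_closure (char_seq (Bfree B)) = admissible C) :
  Erdos R B /\ B = C.
Proof.
have CB : admissible C `<=` orbit_closure (char_seq (Bfree B)) by rewrite X_eq.
have CF : admissible C (char_seq (Bfree B)).
  by rewrite -X_eq; apply: subset_closure; exists 0 => //; exact: shiftz0.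
have BC : B = C.
  apply/seteqP; split => [b Bb|c Cc].
    have [c [Cc cb]] := dvdn_of_admissible_sub _ _ _ B_ge2 C_ge2 CB Bb.
    have [b' [Bb' b'c]] := dvdn_of_admissible _ _ _ C_ge2 C_primitive CF CB Cc.
    (* In the chain [b' %| c %| b], primitivity identifies the two ends, hence all three. *)
    have b'b : b' = b.
      apply: contrapT => ne; have := B_primitive _ _ Bb' Bb ne.
      by rewrite (dvdn_trans b'c cb).
    suff -> : b = c by [].
    by apply/eqP; rewrite eqn_dvd cb -{1}b'b b'c.
  have [b [Bb bc]] := dvdn_of_admissible _ _ _ C_ge2 C_primitive CF CB Cc.
  have [c' [Cc' c'b]] := dvdn_of_admissible_sub _ _ _ B_ge2 C_ge2 CB Bb.
  have c'c : c' = c.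
    apply: contrapT => ne; have := C_primitive _ _ Cc' Cc ne.
    by rewrite (dvdn_trans c'b bc).
  suff -> : c = b by [].
  by apply/eqP; rewrite eqn_dvd bc -{1}c'c c'b.
split=> //; have Binf := infinite_of_admissible_sub _ _ B_ge2 CB.
have Bcop : pairwise_coprime B.
  by apply: pairwise_coprime_of_admissible_sub => //; rewrite {1}BC.
by split=> //; apply: taut_esum_lty => //; exact: infinite_setN0.
Qed.
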